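(* Let $X$ be a compact Hausdorff space and let $T$ be a semigroup of continuous self-maps of $X$ such that the semiflow $(T,X)$ is minimal and universally transitive. Then the following are equivalent: (a) $(T,X)$ is weakly almost periodic; (b) $(T,X)$ is equicontinuous; (c) $(T,X)$ is uniformly almost periodic.
   Context: $X$ is a compact Hausdorff space with its (symmetric) uniform structure $\mathscr{U}_X$; for $x\in X$ and $\varepsilon\in\mathscr{U}_X$ write $\varepsilon[x]=\{y\in X : (x,y)\in\varepsilon\}$. A semiflow $(T,X)$ consists of a topological semigroup $T$ with neutral element $e$ and a jointly continuous map $T\times X\to X$, $(t,x)\mapsto tx$, with $ex=x$ and $(ts)x=t(sx)$ for all $s,t\in T$, $x\in X$. $(T,X)$ is minimal if every orbit $Tx=\{tx:t\in T\}$, $x\in X$, is dense in $X$. $\mathrm{Aut}(T,X)$ is the group of all self-homeomorphisms $a$ of $X$ with $a(tx)=t(ax)$ for all $t\in T$, $x\in X$. $(T,X)$ is universally transitive if $\mathrm{Aut}(T,X)x=X$ for some (equivalently, all) $x\in X$. $(T,X)$ is weakly almost periodic if for every $f\in C(X,\mathbb{R})$ the set $Tf=\{f_t : t\in T\}$, where $f_t(x)=f(tx)$, is relatively compact in $C(X,\mathbb{R})$ with the topology of pointwise convergence. $(T,X)$ is equicontinuous if for every $\varepsilon\in\mathscr{U}_X$ there is $\delta\in\mathscr{U}_X$ such that $(x,y)\in\delta$ implies $(tx,ty)\in\varepsilon$ for all $t\in T$. A subset $A\subseteq T$ is syndetic if there is a compact $K\subseteq T$ with $Kt\cap A\neq\emptyset$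 for every $t\in T$. $(T,X)$ is uniformly almost periodic if for every $\varepsilon\in\mathscr{U}_X$ there is a syndetic subset $A$ of $T$ such that $Ax\subseteq\varepsilon[x]$ for all $x\in X$. *)

(* Defs.v *)
From HB Require Import structures.
From mathcomp Require Import all_boot all_order all_algebra.
From mathcomp Require Import all_classical all_reals.
From mathcomp Require Import topology normedtype.
Import numFieldNormedType.Exports.

Set Implicit Arguments.
Unset Strict Implicit.
Unset Printing Implicit Defensive.

Local Open Scope classical_set_scope.

HB.structure Definition PreTopologicalMonoid :=
  {M of Monoid M & Topological M}.

HB.mixin Record PreTopologicalMonoid_isTopologicalMonoid M
    of PreTopologicalMonoid M := {
  mulg_continuous : continuous (fun xy : M * M => (xy.1 * xy.2)%g)
}.

#[short(type="topologicalMonoidType")]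
HB.structure Definition TopologicalMonoid :=
  {M of PreTopologicalMonoid M & PreTopologicalMonoid_isTopologicalMonoid M}.

Record semiflow (T : topologicalMonoidType) (X : topologicalType) := Semiflow {
  semiflow_act :> T -> X -> X;
  semiflow_continuous :
    continuous (fun tx : T * X => semiflow_act tx.1 tx.2);
  semiflow_act1 : forall x, semiflow_act 1%g x = x;
  semiflow_actM : forall s t x,
    semiflow_act (s * t)%g x = semiflow_act s (semiflow_act t x)
}.

Section TopologicalSemiflow.
Context (T : topologicalMonoidType) (X : topologicalType).
Variable phi : semiflow T X.

Definition orbit (x : X) : set X := [set phi t x | t in [set: T]].

Definition minimal := forall x, dense (orbit x).

Definition Aut : set (X -> X) :=
  [set a | [/\ exists b, [/\ cancel a b, cancel b a & continuous b],
               continuous a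
             & forall t x, a (phi t x) = phi t (a x)]].

Definition universally_transitive :=
  exists x, [set a x | a in Aut] = [set: X].

Lemma act_continuous (t : T) : continuous (phi t).
Proof.
move=> x; apply: (@continuous_comp _ _ _ (fun y => (t, y))
  (fun ty : T * X => phi ty.1 ty.2)); last exact: semiflow_continuous.
by apply: cvg_pair => //=; exact: cvg_cst.
Qed.

Section Translates.
Variable R : realType.

(* C(X, R) with the topology of pointwise convergence. The library puts several
   topologies on continuousType, none of them canonical, so that the one meant
   is given explicitly, as induced by the product topology. *)
Definition Cp := initial_topology (id : continuousType X R -> {ptws X -> R}).

Lemma translate_continuous (f : continuousType X R) (t : T) :
  continuous (f \o phi t).
Proof.
by move=> x; apply: continuous_comp; [exact: act_continuous|exact: cts_fun].
Qed.

Definition translate (f : continuousType X R) (t : T) : continuousType X R :=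
  mkcts (@translate_continuous f t).

Definition weakly_almost_periodic := forall f : continuousType X R,
  precompact ([set translate f t | t in [set: T]] : set Cp).

End Translates.
End TopologicalSemiflow.

Definition syndetic (T : topologicalMonoidType) (A : set T) :=
  exists2 K : set T, compact K &
    forall t, [set (k * t)%g | k in K] `&` A !=set0.

Section UniformSemiflow.
Context (T : topologicalMonoidType) (X : uniformType).
Variable phi : semiflow T X.

(* Uniform over X and over T; the library's equicontinuous is pointwise in X. *)
Definition semiflow_equicontinuous :=
  forall eps : set (X * X), entourage eps ->
  exists2 delta : set (X * X), entourage delta &
    forall x y, delta (x, y) -> forall t, eps (phi t x, phi t y).

Definition uniformly_almost_periodic :=
  forall eps : set (X * X), entourage eps ->
  exists2 A : set T, syndetic A &
    forall x, [set phi t x | t in A] `<=` xsection eps x.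

End UniformSemiflow.

(* Main.v *)
(* By minimality an automorphism with a fixed point is the identity, so Aut(T,X)
   acts simply transitively on X.  Transporting its composition to X through
   x = a_x(e) makes X a group, p.x = a_x(p), whose right translations are
   continuous and in which t acts as left multiplication by te, the points te
   being dense.  Each of (a), (b), (c) is then equivalent to the joint continuity
   of the product.
   For (b) and (c), density passes estimates from the maps t to all left
   multiplications L_p; in (c) the compact set K first makes the inverses of the
   L_p equicontinuous, and these are again all the L_p.
   For (a), relative compactness of Tf makes every f o L_p continuous, so that
   the product is separately continuous, and Ellis' theorem applies: some
   nonempty open set of p's has small oscillation for f(p.x) uniformly in x
   (Namioka, by Saint Raymond's argument), and right translations carry this
   estimate to every point. *)
Require Import Defs.
From mathcomp Require Import all_boot all_order all_algebra.
From mathcomp Require Import all_classical all_reals.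
From mathcomp Require Import topology normedtype sequences.
From mathcomp Require Import lra interval_inference.
Import numFieldNormedType.Exports.
Import Order.TTheory GRing.Theory Num.Theory.

Set Implicit Arguments.
Unset Strict Implicit.
Unset Printing Implicit Defensive.

Local Open Scope classical_set_scope.

(** * Density, entourages and compactness *)

Lemma dense_meets_nbhs (X : topologicalType) (S A : set X) (x : X) :
  dense S -> nbhs x A -> exists2 s, S s & A s.
Proof.
move=> dS; rewrite nbhsE => -[B [oB Bx] BA].
have [s [Bs Ss]] := dS B (ex_intro _ x Bx) oB.
by exists s => //; exact: BA.
Qed.

Lemma closed_cluster (I : Type) (X : topologicalType) (F : set_system I)
    (u : I -> X) (C : set X) :
  closed C -> (\forall i \near F, C (u i)) -> cluster (u @ F) `<=` C.
Proof.
by move=> cC FC x; rewrite clusterE => /(_ C FC); rewrite -(closure_id C).1.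
Qed.

Lemma entourage_split3 (X : uniformType) (eps : set (X * X)) :
  entourage eps -> exists d : set (X * X), [/\ entourage d,
    forall x y, d (x, y) -> d (y, x) &
    forall x y z w, d (x, y) -> d (y, z) -> d (z, w) -> eps (x, w)].
Proof.
move=> eeps; have e1 := entourage_split_ent eeps.
have e2 := entourage_split_ent e1.
exists (split_ent (split_ent eps) `&` (split_ent (split_ent eps))^-1%relation).
split=> [|x y [? ?]//|x y z w [xy _] [yz _] [zw _]].
  exact: entourage_invI.
apply: (entourage_split z) => //; first exact: entourage_split yz.
exact: split_ent_subset.
Qed.

(** Continuity at $(p,x)$ gives an entourage that works on a box around it; compactness of $K \times
    X$ yields one for all boxes. *)
Lemma compact_uniformly_equicontinuous (P : topologicalType) (X : uniformType)
    (K : set P) (mu : P -> X -> X) :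
  compact K -> compact [set: X] ->
  continuous (fun px : P * X => mu px.1 px.2) ->
  forall eps, entourage eps -> exists2 delta, entourage delta &
    forall x y, delta (x, y) -> forall p, K p -> eps (mu p x, mu p y).
Proof.
move=> cK cX cmu eps eeps.
have /compact_near_coveringP cover := compact_setX cK cX.
pose good (delta : set (X * X)) (px : P * X) := forall y, delta (px.2, y) ->
  eps (mu px.1 px.2, mu px.1 y).
have [[x0 _]|noX] := pselect (exists _ : X, True); last first.
  by exists setT => [|x]; [exact: entourageT | case: noX; exists x].
have PE : ProperFilter (@entourage X).
  apply: Build_ProperFilter_ex => A eA; exists (x0, x0); exact: entourage_refl.
(* Near this filter means for all small enough entourages. *)
have PF := (powerset_filter_from_filter PE : Filter _).
have [[p x] _|M [Ment _ [delta Mdelta]] Mgood] := cover _ _ good PF; last first.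
  exists delta => [|x y dxy q Kq]; first exact: Ment.
  exact: (Mgood _ Mdelta (q, x)).
have [d [ed dsym d3]] := entourage_split3 eeps.
have /cvg_entourageP/(_ _ ed) mud := cmu (p, x).
case: mud => -[A B] /= [Ap].
rewrite -nbhs_entourageE => -[E eE EB] AB.
have e3 := entourage_split_ent eE.
exists (A `*` xsection (split_ent E) x,
        [set delta | entourage delta /\ delta `<=` split_ent E]) => /=.
  split; last exact: powerset_filter_fromP.
  exists (A, xsection (split_ent E) x) => //=.
move=> [[p' x'] delta] /= [[Ap' /xsectionP xx'] [_ dE]] y /dE x'y.
have h z : xsection E x z -> d (mu p x, mu p' z).
  by move=> Ez; apply: (AB (p', z)); split=> //=; exact: EB.
apply: (d3 _ (mu p x) (mu p x)); last 2 first.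
- exact: entourage_refl.
- by apply/h/xsectionP; exact: (entourage_split x').
by apply/dsym/h/xsectionP; exact: split_ent_subset.
Qed.

(** * From separate to joint continuity *)

Lemma separately_continuous_small_oscillation (R : realType)
    (X Y : topologicalType) (F : X -> Y -> R) (x0 : X) (e : R) :
  compact [set: X] -> compact [set: Y] ->
  (forall y, continuous (F^~ y)) -> (forall x, continuous (F x)) -> (0 < e)%R ->
  exists U, [/\ open U, U !=set0 &
    forall u v y, U u -> U v -> (`|F u y - F v y| <= e)%R].
Proof.
move=> cX cY cF1 cF2 e0.
(* Two points of [U] are each compared with [u0] through three errors [d]. *)
pose d := (e / 6)%R.
have d0 : (0 < d)%R by rewrite divr_gt0.
have e6 : (e = 6 * d)%R by rewrite /d; lra.
have cgap1 z : continuous (fun u => `|F u z.1 - F u z.2|)%R.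
  by move=> u; apply: cvg_norm; apply: cvgB; exact: cF1.
have cgap2 u : continuous (fun z => `|F u z.1 - F u z.2|)%R.
  move=> z; apply: cvg_norm; apply: cvgB.
    by apply: cvg_comp; [exact: cvg_fst | exact: cF2].
  by apply: cvg_comp; [exact: cvg_snd | exact: cF2].
(* Otherwise points a_n and pairs z_n are chosen alternately so that F a_i nearly
   identifies the two entries of z_n for i < n, whereas F u separates them by d
   for all u in an open set containing every later a_m. At cluster points x of
   (a_n) and w of (z_n), F x both identifies and separates the entries of w. *)
apply: contrapT => noU.
(* The bound shrinks as the list grows, so that the limit pair is identified exactly. *)
pose good (s : seq X) (z : Y * Y) :=
  forall a, a \in s -> (`|F a z.1 - F a z.2| < (size s).+1%:R^-1)%R.
have good_near s y : \forall y' \near y, good s (y, y').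
  have r0 : (0 < (size s).+1%:R^-1 :> R)%R by rewrite invr_gt0 ltr0Sn.
  rewrite /good.
  move: (_.+1%:R^-1)%R r0 => r r0.
  elim: s => [|a s IH]; first by near=> y'.
  near=> y' => b /=; rewrite inE => /predU1P[->|].
    by near: y'; move/cvgrPdist_lt : (cF2 a y); apply.
  by move: b; near: y'.
(* Without such a pair, compactness of [Y] keeps [F u] within [3d] of [F u0] for all [u] near [u0],
   against [noU]. *)
have step (V : set X) (s : seq X) : open V -> V !=set0 ->
    exists z, good s z /\ exists2 u, V u & (d < `|F u z.1 - F u z.2|)%R.
  move=> oV [u0 Vu0]; apply: contrapT => nex.
  have small u z : V u -> good s z -> (`|F u z.1 - F u z.2| <= d)%R.
    move=> Vu gz; rewrite leNgt; apply/negP => dlt.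
    by apply: nex; exists z; split=> //; exists u.
  move: (cY) => /compact_near_coveringP cov.
  have near_u0 : \forall u \near u0, [set: Y] `<=`
      (fun y => `|F u y - F u0 y| <= d + d + d)%R.
    apply: cov => y _.
    have unear : \forall u \near u0, V u /\ (`|F u y - F u0 y| <= d)%R.
      apply: filterI; first exact: open_nbhs_nbhs.
      by move/cvgrPdistC_le : (cF1 y u0); apply.
    exists ([set y' | good s (y, y')],
            [set u | V u /\ (`|F u y - F u0 y| <= d)%R]).
      by split=> /=; [exact: good_near|exact: unear].
    move=> [y' u] /= [gyy' [Vu uu0]].
    have := small u (y, y') Vu gyy'; have := small u0 (y, y') Vu0 gyy'.
    move: uu0 => /=; rewrite !ler_norml => /andP[? ?] /andP[? ?] /andP[? ?].
    by apply/andP; split; lra.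
  apply: noU; move: near_u0; rewrite /prop_near1 nbhsE => -[U [oU Uu0] UP].
  exists U; split=> //; first by exists u0.
  move=> u v y Uu Uv.
  have := UP u Uu y I; have := UP v Uv y I => /=.
  by rewrite !ler_norml => /andP[? ?] /andP[? ?]; apply/andP; split; lra.
(* A state holds the open set, the points chosen so far and the latest pair. Guarding [next] by
   [inv] gives every state a successor, as dependent choice requires. *)
pose inv (st : set X * seq X * (Y * Y)) := open st.1.1 /\ st.1.1 !=set0.
pose next (st st' : set X * seq X * (Y * Y)) := inv st -> [/\ inv st',
  st'.1.1 `<=` st.1.1 `&` [set u | (d < `|F u st'.2.1 - F u st'.2.2|)%R],
  good st.1.2 st'.2 & exists2 a, st'.1.2 = a :: st.1.2 & st'.1.1 a].
have nextP st : {st' | next st st'}.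
  apply: cid; case: (pselect (inv st)) => [|ninv]; last by exists st => /ninv.
  move: st => [[V s] z] [/= oV V0].
  have [z' [gz' [u Vu du]]] := step V s oV V0.
  exists (V `&` [set u | (d < `|F u z'.1 - F u z'.2|)%R], u :: s, z') => _.
  split=> //=; last by exists u.
  split; last by exists u.
  apply: openI => //; apply: (@open_comp _ _ _ [set r | d < r]%R) => [? _|].
    exact: cgap1.
  exact: open_gt.
have [y0 _] : [set: Y] !=set0.
  apply: contrapT => Y0; apply: noU; exists setT; split; first exact: openT.
    by exists x0.
  by move=> u v y; case: Y0; exists y.
have [st [st0 stS]] := dependent_choice nextP ([set: X], [::], (y0, y0)).
have stinv n : inv (st n).
  by elim: n => [|n /stS[]//]; rewrite st0; split; [exact: openT|exists x0].
have stN n := stS n (stinv n).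
have /boolp.choice[a aE] : forall n, exists b,
    (st n.+1).1.2 = b :: (st n).1.2 /\ (st n.+1).1.1 b.
  by move=> n; have [_ _ _ [b]] := stN n; exists b.
have ssize n : size (st n).1.2 = n.
  by elim: n => [|n IH]; rewrite ?st0// (aE n).1 /= IH.
have smem n m : (n < m)%N -> a n \in (st m).1.2.
  elim: m => // m IH; rewrite ltnS leq_eqVlt (aE m).1 inE => /predU1P[->|/IH->].
    by rewrite eqxx.
  by rewrite orbT.
have Vmono n m : (n <= m)%N -> (st m).1.1 `<=` (st n).1.1.
  elim: m => [|m IH]; first by rewrite leqn0 => /eqP ->.
  rewrite leq_eqVlt => /predU1P[->//|/IH Vmn] u.
  by have [_ VS _ _] := stN m => /VS[/Vmn].
pose z n := (st n.+1).2.
have [x [_ xcl]] := cX (a @ \oo) _ filterT.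
have [w [_ wcl]] : (setT `*` setT) `&` cluster (z @ \oo) !=set0.
  by apply: compact_setX => //; exists 0%N.
(* [a n] is in the list at every stage [m > n], where the bound is [1/(m+1)]. *)
have gapa n : (`|F (a n) w.1 - F (a n) w.2| <= 0)%R.
  apply/ler_addgt0Pr => r r0; rewrite add0r.
  apply: (closed_cluster (u := z) _ _ wcl
    (C := [set w | `|F (a n) w.1 - F (a n) w.2| <= r]%R)).
    exact: ((continuous_closedP _).1 (cgap2 (a n)) _ (@closed_le _ _)).
  near=> m; have [_ _ gm _] := stN m; rewrite /= /z.
  apply/ltW/(lt_le_trans (gm (a n) _)).
    by apply: smem; near: m; exact: nbhs_infty_gt.
  rewrite ssize; apply/ltW; near: m; exact: (near_infty_natSinv_lt (PosNum r0)).
have gapx : (`|F x w.1 - F x w.2| <= 0)%R.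
  apply: (closed_cluster (u := a) _ _ xcl
    (C := [set x | `|F x w.1 - F x w.2| <= 0]%R)).
    exact: ((continuous_closedP _).1 (cgap1 w) _ (@closed_le _ _)).
  by near=> n => /=.
(* The open sets decrease, so every [a m] with [m >= n] separates [z n]. *)
have gapz n : (d <= `|F x (z n).1 - F x (z n).2|)%R.
  apply: (closed_cluster (u := a) _ _ xcl
    (C := [set x | d <= `|F x (z n).1 - F x (z n).2|]%R)).
    exact: ((continuous_closedP _).1 (cgap1 (z n)) _ (@closed_ge _ _)).
  near=> m => /=; have [_ VS _ _] := stN n.
  have /VS[_ /ltW//] : (st n.+1).1.1 (a m).
  by apply: (Vmono _ m.+1); [near: m; exact: nbhs_infty_ge | exact: (aE m).2].
have gapw : (d <= `|F x w.1 - F x w.2|)%R.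
  apply: (closed_cluster (u := z) _ _ wcl
    (C := [set w | d <= `|F x w.1 - F x w.2|]%R)).
    exact: ((continuous_closedP _).1 (cgap2 x) _ (@closed_ge _ _)).
  by near=> n => /=.
lra.
Unshelve. all: by end_near.
Qed.

Record right_topological_group (X : topologicalType) := RightTopologicalGroup {
  rtg_mul :> X -> X -> X;
  rtg_one : X;
  rtg_inv : X -> X;
  rtg_mulA : associative rtg_mul;
  rtg_mul1 : left_id rtg_one rtg_mul;
  rtg_mulr1 : right_id rtg_one rtg_mul;
  rtg_mulV : left_inverse rtg_one rtg_inv rtg_mul;
  rtg_mulrV : right_inverse rtg_one rtg_inv rtg_mul;
  rtg_continuous : forall x, continuous (rtg_mul^~ x)
}.

Lemma separately_continuous_joint (R : realType) (X : uniformType)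
    (G : right_topological_group X) :
  compact [set: X] ->
  (forall (f : X -> R) p, continuous f -> continuous (f \o G p)) ->
  continuous (fun z => G z.1 z.2).
Proof.
move=> cX cfG.
(* By complete regularity, real functions detect the neighbourhoods in [X]. *)
suff cf (f : X -> R) : continuous f ->
    continuous (fun z : X * X => f (G z.1 z.2)).
  move=> z N; rewrite nbhsE => -[B [oB Bz] BN].
  have sep : uniform_separator [set G z.1 z.2] (~` B).
    by apply: (@uniform_completely_regular R); [exact: open_closedC | exact].
  pose g : X -> R := Urysohn [set G z.1 z.2] (~` B).
  have g0 : g (G z.1 z.2) = 0%R.
    by apply: (Urysohn_sub0 sep); exists (G z.1 z.2).
  have := cf g (@Urysohn_continuous _ _ _ _) z.
  rewrite /continuous_at g0 => /cvgrPdist_lt/(_ 1%R ltr01) near1.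
  apply: filterS near1 => w /= gw; apply: BN; apply: contrapT => nBw.
  have g1 : g (G w.1 w.2) = 1%R.
    by apply: (Urysohn_sub1 sep); exists (G w.1 w.2).
  by move: gw; rewrite g1 sub0r normrN normr1 ltxx.
move=> cfc [p x]; apply/cvgrPdist_lt => eps eps0 /=.
have eps2 : (0 < eps / 2)%R by rewrite divr_gt0.
have [||U [oU [u Uu] oscU]] := separately_continuous_small_oscillation
  (F := fun p x => f (G p x)) p cX cX _ _ eps2.
- by move=> y q; apply: continuous_comp; [exact: rtg_continuous | exact: cfc].
- by move=> q; exact: (cfG f q cfc).
(* Right translation by [s] sends [p] into [U], and $ry = (rs)(s^{-1}y)$ carries the oscillation
   bound, uniform in the second variable, back to [p]. *)
pose s := G (rtg_inv G p) u.
have ps : G p s = u by rewrite /s rtg_mulA rtg_mulrV rtg_mul1.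
have near1 : \forall q \near p, U (G q s).
  by apply: (@rtg_continuous _ G s p); rewrite /= ps; exact: open_nbhs_nbhs.
have near2 : \forall y \near x, (`|f (G p x) - f (G p y)| < eps / 2)%R.
  by have /cvgrPdist_lt := cfG f p cfc x; apply.
exists ([set q | U (G q s)],
        [set y | `|f (G p x) - f (G p y)| < eps / 2]%R) => //.
move=> [q y] /= [Uq fy].
have split_s r : G r y = G (G r s) (G (rtg_inv G s) y).
  by rewrite -rtg_mulA (rtg_mulA G s) rtg_mulrV rtg_mul1.
have Ups : U (G p s) by rewrite ps.
have := oscU (G p s) (G q s) (G (rtg_inv G s) y) Ups Uq.
rewrite -!split_s; move: fy.
rewrite ler_norml !ltr_norml => /andP[? ?] /andP[? ?].
by apply/andP; split; lra.
Qed.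

(** * The group structure carried over from the automorphisms *)

Section Automorphisms.
Context (T : topologicalMonoidType) (X : topologicalType).
Variable phi : semiflow T X.
Hypothesis X_hausdorff : hausdorff_space X.
Hypothesis phi_minimal : minimal phi.

(** [a] agrees with the identity on the dense orbit of [x]. *)
Lemma Aut_fix (a : X -> X) (x : X) : Aut phi a -> a x = x -> forall y, a y = y.
Proof.
move=> [_ ca aphi] ax y; apply: X_hausdorff => A B nA nB.
have nAB : nbhs y (a @^-1` A `&` B) by apply: filterI => //; exact: ca.
have [_ [t _ <-] [Aat Bt]] := dense_meets_nbhs (phi_minimal x) nAB.
by exists (phi t x); split=> //; move: Aat; rewrite /= aphi ax.
Qed.

Lemma Aut_comp (a b : X -> X) : Aut phi a -> Aut phi b -> Aut phi (a \o b).
Proof.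
move=> [[a' [aK a'K ca']] ca aphi] [[b' [bK b'K cb']] cb bphi]; split.
- exists (b' \o a'); split; [exact: can_comp | exact: can_comp |].
  by move=> x; apply: continuous_comp; [exact: ca' | exact: cb'].
- by move=> x; apply: continuous_comp; [exact: cb | exact: ca].
- by move=> t x /=; rewrite bphi aphi.
Qed.

Lemma Aut_inv (a : X -> X) : Aut phi a ->
  exists2 b, Aut phi b & cancel a b /\ cancel b a.
Proof.
move=> [[b [aK bK cb]] ca aphi]; exists b => //; split=> //; first by exists a.
by move=> t x; rewrite -{1}[x]bK -aphi aK.
Qed.

Lemma Aut_inj (a b : X -> X) (x : X) :
  Aut phi a -> Aut phi b -> a x = b x -> a = b.
Proof.
move=> Aa /[dup] Ab /Aut_inv[b' Ab' [bK b'K]] ab; apply/funext => y.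
apply: (can_inj b'K); rewrite bK.
apply: (Aut_fix (x := x) (Aut_comp Ab' Aa)) => /=.
by rewrite ab bK.
Qed.

Lemma Aut_group : universally_transitive phi ->
  exists G : right_topological_group X,
    forall t x, phi t x = G (phi t (rtg_one G)) x.
Proof.
move=> [e Aute].
have /boolp.choice[a aP] : forall x, exists a, Aut phi a /\ a e = x.
  by move=> x; have : [set: X] x by []; rewrite -Aute => -[a Aa <-]; exists a.
have /boolp.choice[i iP] : forall x, exists y, a x y = e.
  move=> x; have [/Aut_inv[b _ [_ bK]] _] := aP x; by exists (b e).
have Aa x : Aut phi (a x) by have [] := aP x.
have ae x : a x e = x by have [] := aP x.
pose m p x := a x p.
(* Both sides are values at [p] of automorphisms that agree at [e]. *)
have mA : associative m.
  move=> p q r; rewrite /m -[a r (a q p)]/((a r \o a q) p); congr (_ p).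
  by apply: (@Aut_inj _ _ e) => //=; [exact: Aut_comp | rewrite !ae].
have m1 : left_id e m by [].
have mr1 : right_id e m by move=> p; exact: Aut_fix (Aa e) (ae e) p.
have mV : left_inverse e i m by [].
have mrV : right_inverse e i m.
  by move=> x; rewrite -[LHS]m1 -{1}(mV (i x)) -mA (mA (i x)) mV m1 mV.
have mc x : continuous (m^~ x) by have [_] := Aa x.
exists (RightTopologicalGroup mA m1 mr1 mV mrV mc) => t x /=.
by have [_ _ aphi] := Aa x; rewrite /m aphi ae.
Qed.

End Automorphisms.

(** * Separation for pointwise convergence *)

Lemma ptws_hausdorff (R : realType) (X : topologicalType) :
  hausdorff_space {ptws X -> R}.
Proof. by apply: (@hausdorff_product X (fun=> R)) => x; exact: Rhausdorff. Qed.

Lemma Cp_hausdorff (R : realType) (X : topologicalType) :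
  hausdorff_space (Cp X R).
Proof.
move=> f g fg; apply/continuousEP => x.
suff -> : (f : X -> R) = g by [].
apply: ptws_hausdorff => A B nA nB.
have cid := @initial_continuous _ _ (id : continuousType X R -> {ptws X -> R}).
by have [h [Ah Bh]] := fg _ _ (cid f A nA) (cid g B nB); exists (h : X -> R).
Qed.

(** * Each property against joint continuity *)

Section TransitiveSemiflow.
Context (R : realType) (T : topologicalMonoidType) (X : uniformType).
Variables (phi : semiflow T X) (G : right_topological_group X).
Hypothesis X_compact : compact [set: X].
Hypothesis phi_minimal : minimal phi.
Hypothesis phiE : forall t x, phi t x = G (phi t (rtg_one G)) x.

Let one := rtg_one G.

Let joint := continuous (fun z : X * X => G z.1 z.2).

(** Right translations are continuous, so one [t] can imitate [p] at finitely many points; two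
    suffice for estimates on pairs. *)
Lemma orbit_approx (eps : set (X * X)) (p x y : X) : entourage eps ->
  exists t, [/\ eps (p, phi t one), eps (G p x, phi t x)
    & eps (G p y, phi t y)].
Proof.
move=> eeps.
have nearp z : \forall q \near p, eps (G p z, G q z).
  by have /cvg_entourageP/(_ _ eeps) := @rtg_continuous _ G z p.
have nearp0 : \forall q \near p, eps (p, q).
  by apply: filterS (nearp one) => q; rewrite !rtg_mulr1.
have [_ [t _ <-] [pt [xt yt]]] := dense_meets_nbhs (phi_minimal one)
  (filterI nearp0 (filterI (nearp x) (nearp y))).
by exists t; rewrite (phiE t x) (phiE t y).
Qed.

(** Right translation compares $px$ with $qx$, equicontinuity $qx$ with $qy$. *)
Lemma equicontinuous_mul_joint :
  (forall eps, entourage eps -> exists2 delta, entourage delta &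
    forall x y, delta (x, y) -> forall p, eps (G p x, G p y)) -> joint.
Proof.
move=> equi [p x]; apply/cvg_entourageP => eps eeps.
have eeps' := entourage_split_ent eeps.
have [delta edelta Gdelta] := equi _ eeps'.
have nearp : \forall q \near p, split_ent eps (G p x, G q x).
  by have /cvg_entourageP/(_ _ eeps') := @rtg_continuous _ G x p.
exists ([set q | split_ent eps (G p x, G q x)], xsection delta x).
  by split=> //=; exact: nbhs_entourage.
move=> [q y] /= [pq /xsectionP xy].
by apply: (entourage_split (G q x)) => //; exact: Gdelta.
Qed.

Lemma joint_equicontinuous : joint -> semiflow_equicontinuous phi.
Proof.
move=> jG eps eeps.
have [delta edelta dG] :=
  compact_uniformly_equicontinuous X_compact X_compact jG eeps.
by exists delta => // x y /dG dxy t; rewrite phiE (phiE t y); exact: dxy.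
Qed.

Lemma equicontinuous_joint : semiflow_equicontinuous phi -> joint.
Proof.
move=> equi; apply: equicontinuous_mul_joint => eps eeps.
have [d [ed dsym d3]] := entourage_split3 eeps.
have [delta edelta deltaP] := equi _ ed.
exists delta => // x y xy p.
have [t [_ xt yt]] := orbit_approx p x y ed.
by apply: (d3 _ (phi t x) (phi t y)) => //; [exact: deltaP | exact: dsym].
Qed.

(** Some [k] in [K] nearly inverts [t], and the maps in [K] are equicontinuous; hence points with
    close images under [t], or under any [p], are close. *)
Lemma uniformly_almost_periodic_joint : uniformly_almost_periodic phi -> joint.
Proof.
move=> uap; apply: equicontinuous_mul_joint => eps eeps.
have [d [ed dsym d3]] := entourage_split3 eeps.
have [A [K cK KA] Ad] := uap _ ed.
have [delta edelta deltaK] :=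
  compact_uniformly_equicontinuous cK X_compact
    (@semiflow_continuous _ _ phi) ed.
have [d' [ed' dsym' d3']] := entourage_split3 edelta.
have expand x y p : d' (G p x, G p y) -> eps (x, y).
  move=> pxy; have [t [_ xt yt]] := orbit_approx p x y ed'.
  have [_ [[k Kk <-] Akt]] := KA t.
  have near_id z : d (z, phi k (phi t z)).
    by rewrite -semiflow_actM; apply/xsectionP/Ad; exists (k * t)%g.
  apply: (d3 _ _ _ _ (near_id x) _ (dsym _ _ (near_id y))).
  by apply: deltaK => //; apply: d3' pxy _ => //; exact: dsym'.
(* Applied to the inverse of [p], [expand] becomes equicontinuity. *)
exists d' => // x y xy p; apply: (expand _ _ (rtg_inv G p)).
by rewrite !rtg_mulA rtg_mulV !rtg_mul1.
Qed.

(** A finite [K] has some [phi k one] so close to the inverse of [phi t one] that $kt$ is uniformly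
    near the identity. *)
Lemma joint_uniformly_almost_periodic : joint -> uniformly_almost_periodic phi.
Proof.
move=> jG eps eeps.
(* Swapping the factors gives estimates for close left factors, uniform in the right one. *)
have jG' : continuous (fun z : X * X => G z.2 z.1).
  move=> z.
  apply: (@continuous_comp _ _ _ (fun z : X * X => (z.2, z.1)) _ z) (jG _).
  by apply: cvg_pair; [exact: cvg_snd | exact: cvg_fst].
have [delta edelta dG] := compact_uniformly_equicontinuous
  (mu := fun x p => G p x) X_compact X_compact jG' eeps.
have [d [ed dsym d3]] := entourage_split3 edelta.
exists [set t | forall x, eps (x, phi t x)]; last first.
  by move=> x _ [t tA <-]; apply/xsectionP; exact: tA.
(* The finite subsets of T, directed by inclusion, let the near-covering form of
   compactness extract a finite subcover without requiring X to be pointed. *)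
pose F := filter_from [set S : set T | finite_set S]
  (fun S => [set S' | S `<=` S']).
have FF : Filter F.
  apply: filter_from_filter; first by exists set0; exact: finite_set0.
  move=> S S' fS fS'; exists (S `|` S'); first by rewrite /= finite_setU.
  by move=> S'' SS; split; apply: subset_trans SS; [left|right].
have [q _|K fK Kcov] := (compact_near_coveringP [set: X]).1 X_compact _ F
    (fun S q => exists2 k, S k & delta (q, phi k one)) FF; last first.
  exists K; first exact: finite_compact.
  move=> t.
  have [k Kk kt] := Kcov K (@subset_refl _ K) (rtg_inv G (phi t one)) I.
  exists (k * t)%g; split; first by exists k.
  move=> x; rewrite semiflow_actM (phiE k) [phi t x]phiE.
  have := dG _ _ kt (G (phi t one) x) I.
  by rewrite !rtg_mulA rtg_mulV rtg_mul1.
have [t [qt _ _]] := orbit_approx q q q ed.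
exists (xsection d q, [set S | [set t] `<=` S]).
  by split; [exact: nbhs_entourage | exists [set t]; first exact: finite_set1].
move=> [r S] /= [/xsectionP/dsym rq] /(_ t erefl) St.
by exists t => //; apply: d3 rq qt _; exact: entourage_refl.
Qed.

Lemma translation_ptws_continuous (f : X -> R) : continuous f ->
  continuous (fun p => f \o G p : {ptws X -> R}).
Proof.
move=> cf p; apply/pointwise_cvgP => x.
apply: (@continuous_comp _ _ _ (fun p => G p x) f p); last exact: cf.
exact: rtg_continuous.
Qed.

(** The translates lie in the continuous image of the compact [X] under $p \mapsto f \circ L_p$. *)
Lemma joint_weakly_almost_periodic : joint -> weakly_almost_periodic phi R.
Proof.
move=> jG f.
have cfG p : continuous (f \o G p).
  move=> x; apply: continuous_comp; last exact: cts_fun.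
  apply: (@continuous_comp _ _ _ (fun x => (p, x)) _ x) (jG _).
  by apply: cvg_pair; [exact: cvg_cst | exact: cvg_id].
pose h p : Cp X R := mkcts (cfG p).
apply: (@precompact_subset _ _ (h @` setT)).
  move=> _ [t _ <-]; exists (phi t one) => //.
  by apply/continuousEP => x /=; rewrite /mkcts /= -phiE.
apply: compact_precompact; first exact: Cp_hausdorff.
apply: continuous_compact => //; apply: continuous_subspaceT.
apply: continuous_comp_initial; apply: translation_ptws_continuous.
exact: cts_fun.
Qed.

(** [f \o G p] is a pointwise limit of translates, as [phi t one] tends to [p]. *)
Lemma weakly_almost_periodic_joint : weakly_almost_periodic phi R -> joint.
Proof.
move=> wap; apply: (@separately_continuous_joint R) => // f p cf.
have [U tU [cU _]] := wap (mkcts cf).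
(* As [f \o G p] is not yet known to be continuous, the limit is taken in the full product, where
   the compact [V] is closed. *)
pose V : set {ptws X -> R} := (fun u : Cp X R => (u : X -> R)) @` U.
have cV : closed V.
  apply: compact_closed; first exact: ptws_hausdorff.
  apply: continuous_compact => //; apply: continuous_subspaceT.
  exact: initial_continuous.
suff [u _ <-] : V (f \o G p) by exact: cts_fun.
apply: contrapT => nV.
have nbhs_p : nbhs p ((fun p => f \o G p : {ptws X -> R}) @^-1` (~` V)).
  apply: (translation_ptws_continuous cf); apply: open_nbhs_nbhs; split=> //.
  exact: closed_openC.
have [_ [t _ <-]] := dense_meets_nbhs (phi_minimal one) nbhs_p; apply.
exists (translate phi (mkcts cf) t); first by apply: tU; exists t.
by apply/funext => x /=; rewrite -phiE.
Qed.

End TransitiveSemiflow.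

(* T is a semigroup of self-maps of X: its elements act as pairwise distinct
   maps, and semiflow makes its product and unit composition and identity. *)
Theorem theorem2p32 (R : realType) (X : uniformType)
    (T : topologicalMonoidType) (phi : semiflow T X)
    (X_compact : compact [set: X]) (X_hausdorff : hausdorff_space X)
    (phi_injective : injective phi)
    (phi_minimal : minimal phi)
    (phi_transitive : universally_transitive phi) :
  (weakly_almost_periodic phi R <-> semiflow_equicontinuous phi) /\
  (semiflow_equicontinuous phi <-> uniformly_almost_periodic phi).
Proof.
have [G phiE] := Aut_group X_hausdorff phi_minimal phi_transitive.
have wap_joint :=
  weakly_almost_periodic_joint (R := R) X_compact phi_minimal phiE.
have joint_wap := joint_weakly_almost_periodic (R := R) X_compact phiE.
have equi_joint := equicontinuous_joint phi_minimal phiE.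
have joint_equi := joint_equicontinuous X_compact phiE.
have uap_joint := uniformly_almost_periodic_joint X_compact phi_minimal phiE.
have joint_uap := joint_uniformly_almost_periodic X_compact phi_minimal phiE.
by split; split=> ?; auto.
Qed.
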